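(* Let $1<p<\infty$ and let $\mathcal{B}_1(\ell_p)$ be the set of all bounded linear operators $T$ on the real or complex space $\ell_p$ with $\|T\|\le1$. Then a typical $T\in(\mathcal{B}_1(\ell_p),\mathtt{SOT}^* )$ does not attain its norm; that is, the set of all $T\in\mathcal{B}_1(\ell_p)$ for which there is no $x$ in the closed unit ball of $\ell_p$ with $\|Tx\|=\|T\|$ is comeager in $(\mathcal{B}_1(\ell_p),\mathtt{SOT}^* )$.
   Context: $\mathtt{SOT}^*$ is the topology in which $T_i\to T$ iff $T_ix\to Tx$ in norm for all $x\in X$ and $T_i^*x^*\to T^*x^*$ in norm for all $x^*\in X^*$ (here $X=\ell_p$). A set is comeager if its complement is a countable union of nowhere dense sets; a property is typical if the set of elements satisfying it is comeager. *)

(* Defs.v *)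
From HB Require Import structures.
From mathcomp Require Import all_boot all_order all_algebra.
From mathcomp Require Import complex.
From mathcomp Require Import all_classical all_reals all_analysis.

Set Implicit Arguments.
Unset Strict Implicit.
Unset Printing Implicit Defensive.

Import Order.TTheory GRing.Theory Num.Theory.
Import numFieldNormedType.Exports.

Local Open Scope classical_set_scope.
Local Open Scope ring_scope.

Section Category.
Context {T : topologicalType}.

Definition nowhere_dense (A : set T) : Prop := interior (closure A) = set0.

Definition comeager (A : set T) : Prop :=
  exists2 F : nat -> set T,
    (forall n, nowhere_dense (F n)) & ~` A = \bigcup_n F n.

End Category.

Variant scalar_kind := RealScalars | ComplexScalars.

Definition scalars (R : realType) (k : scalar_kind) : numFieldType :=
  match k with RealScalars => R | ComplexScalars => R[i] end.

(* Norms on a normed space over K take their values in K, so real quantities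
   (p-th powers, series, suprema) are computed in R and sent back to K. *)
Definition of_real (R : realType) (k : scalar_kind) : R -> scalars R k :=
  match k with RealScalars => id | ComplexScalars => fun r => r%:C%C end.

Definition real_part (R : realType) (k : scalar_kind) : scalars R k -> R :=
  match k with RealScalars => id | ComplexScalars => @complex.Re R end.

Arguments of_real {R} k r.
Arguments real_part {R k} z.

Section ScalarTheory.
Context {R : realType} {k : scalar_kind}.
Local Notation K := (scalars R k).
Implicit Types (r s : R) (z w : K).

Lemma of_realK : cancel (of_real k) (@real_part R k).
Proof. by case: k. Qed.

Lemma of_real0 : of_real k 0 = 0 :> K.
Proof. by case: k. Qed.

Lemma of_real1 : of_real k 1 = 1 :> K.
Proof. by case: k. Qed.

Lemma of_realD r s : of_real k (r + s) = of_real k r + of_real k s.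
Proof. by case: k => //=; rewrite rmorphD. Qed.

Lemma of_realM r s : of_real k (r * s) = of_real k r * of_real k s.
Proof. by case: k => //=; rewrite rmorphM. Qed.

Lemma of_real_le r s : (of_real k r <= of_real k s) = (r <= s).
Proof. by case: k => //=; rewrite lecR. Qed.

Lemma real_part_nneg z : 0 <= z -> of_real k (real_part z) = z.
Proof. by case: k z => //= -[a b]; rewrite lecE /= => /andP[/eqP-> _]. Qed.

Definition rnorm (V : normedZmodType K) (x : V) : R := real_part `|x|.

Section rnorm.
Context {V : normedZmodType K}.
Implicit Types x y : V.

Lemma of_real_rnorm x : of_real k (rnorm x) = `|x|.
Proof. exact: real_part_nneg. Qed.

Lemma rnorm_ge0 x : 0 <= rnorm x.
Proof. by rewrite -of_real_le of_real_rnorm of_real0. Qed.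

Lemma rnormD x y : rnorm (x + y) <= rnorm x + rnorm y.
Proof. by rewrite -of_real_le of_realD !of_real_rnorm ler_normD. Qed.

Lemma rnorm0 : rnorm (0 : V) = 0.
Proof. by rewrite /rnorm normr0 -of_real0 of_realK. Qed.

Lemma rnorm_eq0 x : rnorm x = 0 -> x = 0.
Proof.
by move=> x0; apply/eqP; rewrite -normr_eq0 -of_real_rnorm x0 of_real0.
Qed.

End rnorm.

Lemma rnormZ (V : normedModType K) z (x : V) :
  rnorm (z *: x) = rnorm (z : K^o) * rnorm x.
Proof.
apply: (can_inj of_realK).
by rewrite of_realM !of_real_rnorm normrZ.
Qed.

End ScalarTheory.

Section Lp.
Context {R : realType} (k : scalar_kind) {p : R} (p1 : 1 < p).
Local Notation K := (scalars R k).
Implicit Types x y : nat -> K.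

Definition lp_sum x : \bar R :=
  (\sum_(0 <= n <oo) (rnorm (x n : K^o) `^ p)%:E)%E.

(* [1 < p] is not used here: it is an index from which the proof that the
   predicate is closed under linear combinations is recovered. *)
Definition lp_pred of 1 < p : {pred nat -> K} :=
  fun x => `[< (lp_sum x < +oo)%E >].

Definition lp_seqnorm x : R := fine (lp_sum x) `^ p^-1.

Let p_gt0 : 0 < p. Proof. exact: lt_trans p1. Qed.

Lemma lp_sum_ge0 x : (0 <= lp_sum x)%E.
Proof. by apply: nneseries_ge0 => n _ _; rewrite lee_fin powR_ge0. Qed.

Lemma lp_sum_Lnorm x :
  ('N[counting]_p%:E[EFin \o (fun n => rnorm (x n : K^o))]
    = lp_sum x `^ p^-1)%E.
Proof.
rewrite Lnorm_counting//; congr (_ `^ _)%E; apply: eq_eseriesr => n _ /=.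
by rewrite ger0_norm// rnorm_ge0.
Qed.

Lemma lp_seqnormE x : x \in lp_pred p1 ->
  ((lp_seqnorm x)%:E = lp_sum x `^ p^-1)%E.
Proof.
move=> /asboolP xlp; rewrite /lp_seqnorm -poweR_EFin fineK//.
by rewrite ge0_fin_numE// lp_sum_ge0.
Qed.

Lemma lp_sum_poweRD x y :
  (lp_sum (x + y)%R `^ p^-1 <= lp_sum x `^ p^-1 + lp_sum y `^ p^-1)%E.
Proof.
pose f z n := rnorm ((z : nat -> K) n : K^o).
rewrite -!lp_sum_Lnorm.
apply: (@le_trans _ _ ('N[counting]_p%:E[EFin \o (f x \+ f y)%R])%E).
  rewrite !Lnorm_counting//; apply: gt0_ler_poweR.
  - by rewrite invr_ge0 ltW.
  - by rewrite in_itv /= leey andbT nneseries_ge0// => *; exact: poweR_ge0.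
  - by rewrite in_itv /= leey andbT nneseries_ge0// => *; exact: poweR_ge0.
  apply: lee_nneseries => n _; first by move=> *; exact: poweR_ge0.
  rewrite /= lee_fin ge0_ler_powR ?nnegrE ?(ltW p_gt0)//.
  rewrite !ger0_norm ?addr_ge0 ?rnorm_ge0//.
  exact: rnormD.
by apply: minkowski_EFin => //; exact: ltW.
Qed.

Lemma lp_sumZ (a : K) x :
  lp_sum (a *: x)%R = (((rnorm (a : K^o) `^ p)%R)%:E * lp_sum x)%E.
Proof.
rewrite /lp_sum -nneseriesZl; last by move=> n _; rewrite lee_fin powR_ge0.
by apply: eq_eseriesr => n _; rewrite rnormZ powRM ?rnorm_ge0// EFinM.
Qed.

Lemma lp_sum0 : lp_sum 0 = 0%E.
Proof.
rewrite /lp_sum eseries0// => n _ _.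
by rewrite (rnorm0 (V := K^o)) powR0// gt_eqF.
Qed.

Lemma lp_submod_closed : submod_closed (lp_pred p1).
Proof.
split; first by apply/asboolP; rewrite lp_sum0 ltry.
move=> a x y /asboolP xlp /asboolP ylp; apply/asboolP.
have axlp : (lp_sum (a *: x)%R < +oo)%E.
  by rewrite lp_sumZ lte_mul_pinfty ?lee_fin ?powR_ge0.
have := lp_sum_poweRD (a *: x) y.
rewrite ltey; apply: contraTneq => ->.
rewrite poweRyr ?invr_eq0 ?gt_eqF// leye_eq -ltey lte_add_pinfty// poweR_lty//.
Qed.

HB.instance Definition _ :=
  GRing.isSubmodClosed.Build K (nat -> K) (lp_pred p1) lp_submod_closed.

Record lp := Lp { lp_val :> nat -> K; _ : lp_val \in lp_pred p1 }.

HB.instance Definition _ := [isSub for lp_val].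
HB.instance Definition _ := [Choice of lp by <:].
HB.instance Definition _ := [SubChoice_isSubLmodule of lp by <:].

Definition lp_norm (x : lp) : K := of_real k (lp_seqnorm x).

Lemma lp_seqnorm_val (x : lp) :
  ((lp_seqnorm x)%:E = lp_sum x `^ p^-1)%E.
Proof. by apply: lp_seqnormE; case: x. Qed.

Lemma lp_normD (x y : lp) : lp_norm (x + y) <= lp_norm x + lp_norm y.
Proof.
rewrite /lp_norm -of_realD of_real_le -lee_fin EFinD.
rewrite [X in (X <= _)%E]lp_seqnorm_val [X in (_ <= X + _)%E]lp_seqnorm_val.
rewrite [X in (_ <= _ + X)%E]lp_seqnorm_val.
exact: lp_sum_poweRD.
Qed.

Lemma lp_normZ (a : K) (x : lp) : lp_norm (a *: x) = `|a| * lp_norm x.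
Proof.
rewrite /lp_norm -[`|a|](of_real_rnorm (a : K^o)) -of_realM.
congr (of_real k _); apply: EFin_inj; rewrite EFinM.
rewrite [LHS]lp_seqnorm_val [X in (_ = _ * X)%E]lp_seqnorm_val.
rewrite [X in (X `^ _ = _)%E]lp_sumZ poweRM ?lp_sum_ge0 ?lee_fin ?powR_ge0// poweR_EFin.
by rewrite -powRrM divff ?powRr1 ?rnorm_ge0 ?gt_eqF.
Qed.

Lemma lp_norm_eq0 (x : lp) : lp_norm x = 0 -> x = 0.
Proof.
rewrite /lp_norm -(@of_real0 R k) => lpx0.
have := congr1 EFin (can_inj of_realK lpx0).
rewrite [LHS]lp_seqnorm_val => /(poweR_eq0_eq0 (lp_sum_ge0 x)) x0.
apply: val_inj; apply/funext => n /=.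
apply: (@rnorm_eq0 _ _ K^o); apply: (@powR_eq0_eq0 _ _ p).
apply/eqP; rewrite -eqe; apply/eqP/le_anti/andP; split.
  rewrite -[leRHS]x0 /lp_sum (nneseriesD1 (n := n))//; last first.
    by move=> m _; rewrite lee_fin powR_ge0.
  by rewrite leeDl// nneseries_ge0// => m _ _; rewrite lee_fin powR_ge0.
by rewrite lee_fin powR_ge0.
Qed.

HB.instance Definition _ := @Lmodule_isNormed.Build K lp lp_norm
  lp_normD lp_normZ lp_norm_eq0.

End Lp.

Section BoundedOperators.
Context {R : realType} {k : scalar_kind}.
Local Notation K := (scalars R k).
Context (X Y : normedModType K).
Implicit Types (f g : X -> Y) (M : K).

Definition bounded_op_pred : {pred X -> Y} :=
  fun f => `[< linear f /\ exists M, forall x, `|f x| <= M * `|x| >].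

Lemma bounded_op_pred_submod_closed : submod_closed bounded_op_pred.
Proof.
split.
  apply/asboolP; split; first by move=> a x y; rewrite scaler0 addr0.
  by exists 0 => x; rewrite mul0r normr0.
move=> a f g /asboolP[lf [M fM]] /asboolP[lg [N gN]]; apply/asboolP; split.
  move=> b x y; rewrite /= !fctE /= lf lg.
  by rewrite !scalerDr !scalerA [a * b]mulrC addrACA.
exists (`|a| * M + N) => x; rewrite fctE mulrDl (le_trans (ler_normD _ _))//.
by rewrite lerD// normrZ -mulrA ler_wpM2l.
Qed.

HB.instance Definition _ := GRing.isSubmodClosed.Build K (X -> Y)
  bounded_op_pred bounded_op_pred_submod_closed.

Record bounded_op :=
  BoundedOp { bounded_op_val :> X -> Y; _ : bounded_op_val \in bounded_op_pred }.

HB.instance Definition _ := [isSub for bounded_op_val].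
HB.instance Definition _ := [Choice of bounded_op by <:].
HB.instance Definition _ := [SubChoice_isSubLmodule of bounded_op by <:].
Implicit Types S T : bounded_op.

Lemma bounded_op_linear T : linear T.
Proof. by case: T => f /= /asboolP[]. Qed.

HB.instance Definition _ T :=
  GRing.isLinear.Build K X Y *:%R T (bounded_op_linear T).

Lemma bounded_opP T : exists2 M : R, 0 <= M &
  forall x, rnorm (T x) <= M * rnorm x.
Proof.
case: T => f /= /asboolP[_ [M fM]]; exists (rnorm (M : K^o)).
  exact: rnorm_ge0.
move=> x; rewrite -(of_real_le (k := k)) of_realM !of_real_rnorm.
rewrite -[`|x|]normr_id -normrM (le_trans (fM x))// real_ler_norm//.
by rewrite ger0_real// (le_trans _ (fM x)).
Qed.

Definition op_norm T : R := sup [set rnorm (T x) | x in [set x | `|x| <= 1]].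

Lemma op_norm_has_sup T :
  has_sup [set rnorm (T x) | x in [set x | `|x| <= 1]].
Proof.
split; first by exists (rnorm (T 0)), 0 => //=; rewrite normr0.
have [M M0 TM] := bounded_opP T; exists M => _ [x /= x1 <-].
rewrite (le_trans (TM x))// ler_piMr//.
by rewrite -(of_real_le (k := k)) of_real_rnorm (le_trans x1)// of_real1.
Qed.

Lemma op_norm_ge T x : `|x| <= 1 -> rnorm (T x) <= op_norm T.
Proof. by move=> x1; apply: sup_upper_bound (op_norm_has_sup T) _ _; exists x. Qed.

Lemma op_norm_le T (M : R) :
  (forall x, `|x| <= 1 -> rnorm (T x) <= M) -> op_norm T <= M.
Proof.
move=> TM; apply: sup_le_ub => [|_ [x /= x1 <-]]; last exact: TM.
by case: (op_norm_has_sup T).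
Qed.

Lemma op_norm_ge0 T : 0 <= op_norm T.
Proof. by rewrite (le_trans (rnorm_ge0 (T 0)))// op_norm_ge// normr0. Qed.

Lemma rnorm_op_le T x : rnorm (T x) <= op_norm T * rnorm x.
Proof.
have [->|x0] := eqVneq x 0; first by rewrite raddf0 !rnorm0 mulr0.
have nx0 : `|x| != 0 by rewrite normr_eq0.
have nux : `| `|x|^-1 *: x | = 1.
  by rewrite normrZ normfV normr_id mulVf.
rewrite -{1}[x](scalerKV nx0) linearZ rnormZ mulrC.
have -> : rnorm (`|x| : K^o) = rnorm x by rewrite /rnorm normr_id.
by rewrite ler_wpM2r ?rnorm_ge0// op_norm_ge// nux.
Qed.

Lemma op_normD S T : op_norm (S + T) <= op_norm S + op_norm T.
Proof.
apply: op_norm_le => x x1; rewrite (le_trans (rnormD _ _))//.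
by rewrite lerD// op_norm_ge.
Qed.

Lemma op_normZ_le (a : K) T :
  op_norm (a *: T) <= rnorm (a : K^o) * op_norm T.
Proof.
apply: op_norm_le => x x1; rewrite rnormZ.
by rewrite ler_wpM2l ?rnorm_ge0// op_norm_ge.
Qed.

Lemma op_normZ (a : K) T : op_norm (a *: T) = rnorm (a : K^o) * op_norm T.
Proof.
apply/le_anti; rewrite op_normZ_le /=.
have [->|a0] := eqVneq a 0.
  by rewrite (rnorm0 (V := K^o)) mul0r op_norm_ge0.
have := op_normZ_le a^-1 (a *: T); rewrite scalerK//.
move=> /(ler_wpM2l (rnorm_ge0 (a : K^o))) /le_trans; apply.
rewrite mulrA -[_ * rnorm _](rnormZ a (a^-1 : K^o)).
rewrite [a *: _](mulfV a0) {1}/rnorm normr1 -(of_real1 (k := k)) of_realK.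
by rewrite mul1r.
Qed.

Lemma op_norm_eq0 T : op_norm T = 0 -> T = 0.
Proof.
move=> T0; apply: val_inj; apply/funext => x; apply: rnorm_eq0.
by apply/le_anti; rewrite rnorm_ge0 (le_trans (rnorm_op_le T x))// T0 mul0r.
Qed.

Definition bounded_op_norm T : K := of_real k (op_norm T).

Lemma bounded_op_normD S T :
  bounded_op_norm (S + T) <= bounded_op_norm S + bounded_op_norm T.
Proof. by rewrite /bounded_op_norm -of_realD of_real_le op_normD. Qed.

Lemma bounded_op_normZ (a : K) T :
  bounded_op_norm (a *: T) = `|a| * bounded_op_norm T.
Proof.
by rewrite /bounded_op_norm op_normZ of_realM (of_real_rnorm (a : K^o)).
Qed.

Lemma bounded_op_norm_eq0 T : bounded_op_norm T = 0 -> T = 0.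
Proof.
rewrite /bounded_op_norm -(@of_real0 R k) => T0.
exact: op_norm_eq0 (can_inj (@of_realK R k) T0).
Qed.

HB.instance Definition _ := @Lmodule_isNormed.Build K bounded_op bounded_op_norm
  bounded_op_normD bounded_op_normZ bounded_op_norm_eq0.

End BoundedOperators.

Arguments bounded_op_pred {R k} X Y _.

Section SOTStar.
Context {R : realType} {k : scalar_kind}.
Local Notation K := (scalars R k).
Context (X : normedModType K).

Definition dual : normedModType K := bounded_op X K^o.

Lemma adjoint_subproof (T : bounded_op X X) (f : dual) :
  (f : bounded_op X K^o) \o T \in bounded_op_pred X K^o.
Proof.
have [M M0 TM] := bounded_opP T; have [N N0 fN] := bounded_opP f.
apply/asboolP; split; first by move=> a x y; rewrite /= !linearP.
exists (of_real k (N * M)) => x.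
rewrite -!(@of_real_rnorm _ k) -of_realM of_real_le -mulrA /=.
by rewrite (le_trans (fN _))// ler_wpM2l.
Qed.

Definition adjoint (T : bounded_op X X) (f : dual) : dual :=
  BoundedOp (adjoint_subproof T f).

(* The operators on X with the coarsest topology making T |-> T x and
   T |-> T^* f continuous for all x in X and f in X^*, where X and X^* carry
   their norm topologies. As a bare type this is [bounded_op X X], whose own
   topology is that of the operator norm. *)
Definition sot_star : Type := bounded_op X X.

Definition sot_star_eval (T : sot_star) :
    {ptws X -> X} * {ptws dual -> dual} :=
  (bounded_op_val T, adjoint T).

HB.instance Definition _ := Choice.on sot_star.
HB.instance Definition _ :=
  Topological.copy sot_star (initial_topology sot_star_eval).

Definition op_unit_ball : set sot_star :=
  [set T | `|T : bounded_op X X| <= 1].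

Lemma cvg_sot_star (F : set_system sot_star) (T : sot_star) : Filter F ->
  F --> T <->
  (forall x : X, bounded_op_val S x @[S --> F] --> bounded_op_val T x) /\
  (forall f : dual, adjoint S f @[S --> F] --> adjoint T f).
Proof.
move=> FF.
have ev_cont : continuous sot_star_eval by exact: initial_continuous.
have P1 := @pointwise_cvgP X X (@bounded_op_val R k X X @ F)
  (bounded_op_val T) _.
have P2 := @pointwise_cvgP dual dual (adjoint @ F) (adjoint T) _.
split=> [FT|[/P1 F1 /P2 F2]].
  have FeT : sot_star_eval @ F --> sot_star_eval T.
    by move=> A /(ev_cont T); exact: FT.
  split; first by apply/P1; exact: (cvg_comp _ _ FeT cvg_fst).
  by apply/P2; exact: (cvg_comp _ _ FeT cvg_snd).
have FeT : sot_star_eval @ F --> sot_star_eval T by exact: cvg_pair F1 F2.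
move=> A; rewrite nbhsE => -[_ [[B oB <-] BT] BA].
by apply: (filterS BA); apply: FeT; exact: open_nbhs_nbhs.
Qed.

End SOTStar.

Arguments op_unit_ball {R k} X _.

Definition attains_norm (R : realType) (k : scalar_kind)
    (X Y : normedModType (scalars R k)) (T : bounded_op X Y) : Prop :=
  exists2 x : X, `|x| <= 1 & `|T x| = `|T|.

(* Main.v *)
Require Import Defs.
From HB Require Import structures.
From mathcomp Require Import all_boot all_order all_algebra.
From mathcomp Require Import all_classical all_reals all_analysis.
From mathcomp Require Import lra.

Set Implicit Arguments.
Unset Strict Implicit.
Unset Printing Implicit Defensive.

Import Order.TTheory GRing.Theory Num.Theory.
Import numFieldNormedType.Exports.

Local Open Scope classical_set_scope.
Local Open Scope ring_scope.

(** If a contraction T attains its norm, it does so at some x of the unit ball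
    with a nonzero coordinate (if T = 0, at a basis vector). The norm-attaining
    contractions are therefore the union over m of the sets
    [attains_at_coord m], where the maximising x has a coordinate of index at
    most m and modulus at least 1 / (m + 1); it suffices that each of these is
    nowhere dense.

    Write P x = [trunc n x] for the first n coordinates of x and
    Q x = [tail n x] for the others, so that |x|^p = |P x|^p + |Q x|^p. Any
    contraction T is the SOT*-limit, as n grows, of the contractions
      S0 = r P T P + e_n (x) e_n^*,   r = 1 - 1 / (n + 1),
    called [approx T n] ([approx_cvg]). Convergence at vectors holds because
    r tends to 1 and |Q x| to 0. Convergence of the adjoints requires |f o Q|
    to tend to 0 for every functional f, and this is where p > 1 enters
    ([dual_tail_small]).

    Around S0 the situation is rigid. Let S be a contraction close to S0 at
    e_0, ..., e_n, with adjoint close to that of S0 at e_0^*, ..., e_(n-1)^*.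
    As P S0 Q = 0, up to a small error S x is r P T P x + Q S Q x, so
    |S x|^p <= r^p |P x|^p + |Q x|^p <= 1 - (1 - r^p) |P x|^p
    on the unit ball, up to that error. The coordinate e_n is kept by S0, which
    forces |S| to be almost 1. Hence S does not attain its norm at an x for
    which |P x| is bounded below ([near_approx_non_attaining]), in particular
    at an x with a coordinate of index at most m < n and modulus at least
    1 / (m + 1). So a whole neighbourhood of S0 avoids [attains_at_coord m]
    ([nowhere_dense_attains_at_coord]). *)

(** * Powers of reals *)

Lemma ler_powR2r (R : realType) (r x y : R) : 0 < r -> 0 <= x -> 0 <= y ->
  (x `^ r <= y `^ r) = (x <= y).
Proof.
move=> r0 x0 y0; case: (leP x y) => xy.
  by rewrite ge0_ler_powR ?nnegrE// ltW.
by apply/negbTE; rewrite -ltNge gt0_ltr_powR ?nnegrE.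
Qed.

Lemma ler_powR_1 (R : realType) (r x : R) : 0 < r -> 0 <= x ->
  (x `^ r <= 1) = (x <= 1).
Proof. by move=> r0 x0; rewrite -(ler_powR2r r0 x0 ler01) powR1. Qed.

Lemma ltr_powR_1 (R : realType) (s y : R) :
  0 < s -> 0 <= y -> y < 1 -> y `^ s < 1.
Proof.
move=> s0 y0 y1; have := @gt0_ltr_powR _ s s0 y 1.
by rewrite powR1; apply; rewrite ?nnegrE.
Qed.

(** * Norms with real values *)

Section RealNorm.
Context {R : realType} {k : scalar_kind}.
Local Notation K := (scalars R k).

Lemma of_realB (r s : R) : of_real k (r - s) = of_real k r - of_real k s.
Proof. by apply/eqP; rewrite eq_sym subr_eq -of_realD subrK. Qed.

Lemma of_real_lt (r s : R) : (of_real k r < of_real k s) = (r < s).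
Proof. by rewrite lt_def (can_eq (@of_realK R k)) of_real_le -lt_def. Qed.

Lemma rnorm_le (V : normedZmodType K) (x : V) (r : R) :
  (`|x| <= of_real k r) = (rnorm x <= r).
Proof. by rewrite -of_real_rnorm of_real_le. Qed.

Lemma rnorm_le1 (V : normedZmodType K) (x : V) : (`|x| <= 1) = (rnorm x <= 1).
Proof. by rewrite -rnorm_le of_real1. Qed.

Lemma rnormN (V : normedZmodType K) (x : V) : rnorm (- x) = rnorm x.
Proof. by rewrite /rnorm normrN. Qed.

Lemma rnorm_sum (V : normedZmodType K) I (r : seq I) (F : I -> V) :
  rnorm (\sum_(i <- r) F i) <= \sum_(i <- r) rnorm (F i).
Proof.
elim/big_ind2 : _ => [|a b c d ab cd|//]; first by rewrite rnorm0.
by rewrite (le_trans (rnormD _ _))// lerD.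
Qed.

Lemma rnormD4 (V : normedZmodType K) (a b c d : V) (A B C D : R) :
  rnorm a <= A -> rnorm b <= B -> rnorm c <= C -> rnorm d <= D ->
  rnorm (a + b + c + d) <= A + B + C + D.
Proof.
move=> aA bB cC dD; apply: le_trans (rnormD _ _) _; apply: lerD => //.
apply: le_trans (rnormD _ _) _; apply: lerD => //.
by apply: le_trans (rnormD _ _) _; apply: lerD.
Qed.

Lemma rnorm_of_real (r : R) : 0 <= r -> rnorm (of_real k r : K^o) = r.
Proof.
move=> r0; rewrite /rnorm ger0_norm ?of_realK//.
by rewrite -(@of_real0 R k) of_real_le.
Qed.

Lemma rnorm_op (V W : normedModType K) (T : bounded_op V W) :
  rnorm T = op_norm T.
Proof. exact: of_realK. Qed.

Lemma rnorm_lp (p : R) (p1 : 1 < p) (x : lp k p1) :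
  rnorm x = lp_seqnorm (p := p) x.
Proof. exact: of_realK. Qed.

End RealNorm.

(** * Truncations and tails of p-summable sequences *)

Section Coordinates.
Context {R : realType} {k : scalar_kind} {p : R} (p1 : 1 < p).
Local Notation K := (scalars R k).
Local Notation X := (lp k p1).
Implicit Types (x y : X) (i j n : nat).

Let p_gt0 : 0 < p. Proof. exact: lt_trans p1. Qed.

Let p_neq0 : p != 0. Proof. by rewrite gt_eqF. Qed.

Lemma rnorm_powE x : (rnorm x `^ p)%:E = lp_sum (p := p) x.
Proof.
rewrite rnorm_lp -poweR_EFin lp_seqnorm_val -poweRrM mulVf//.
by rewrite poweRe1 ?lp_sum_ge0.
Qed.

Lemma rnorm_le_pow x y : (rnorm x <= rnorm y) = (rnorm x `^ p <= rnorm y `^ p).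
Proof. by rewrite ler_powR2r ?rnorm_ge0. Qed.

Lemma lp_coordD x y i : (x + y) i = x i + y i. Proof. by []. Qed.
Lemma lp_coordB x y i : (x - y) i = x i - y i. Proof. by []. Qed.
Lemma lp_coordZ (a : K) x i : (a *: x) i = a * x i. Proof. by []. Qed.

Lemma lp_coord_sum I (r : seq I) (F : I -> X) i :
  (\sum_(j <- r) F j : X) i = \sum_(j <- r) F j i.
Proof. by elim/big_rec2 : _ => // j a b _ <-. Qed.

Lemma lp_ext x y : (forall i, x i = y i) -> x = y.
Proof. by move=> xy; apply: val_inj; apply/funext. Qed.

(** The p-th power of the norm is a sum over coordinates, hence additive on
    disjointly supported sequences; all estimates below rest on this. *)
Lemma rnorm_pow_disjoint x y : (forall i, x i = 0 \/ y i = 0) ->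
  rnorm (x + y) `^ p = rnorm x `^ p + rnorm y `^ p.
Proof.
move=> xy; apply: EFin_inj.
apply: etrans (rnorm_powE (x + y)) _.
apply: etrans (esym (congr2 adde (rnorm_powE x) (rnorm_powE y))).
rewrite /lp_sum -[RHS]nneseriesD; last 2 first.
- by move=> i _ _; rewrite lee_fin powR_ge0.
- by move=> i _ _; rewrite lee_fin powR_ge0.
apply: eq_eseriesr => i _.
rewrite -EFinD lp_coordD; congr EFin.
have z0 : rnorm (0 : K^o) `^ p = 0 by rewrite rnorm0 powR0.
by case: (xy i) => ->; rewrite ?add0r ?addr0 z0 ?add0r ?addr0.
Qed.

Lemma rnorm_coord x i : rnorm (x i : K^o) <= rnorm x.
Proof.
rewrite -(@ler_powR2r _ p) ?rnorm_ge0//.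
rewrite -lee_fin rnorm_powE /lp_sum (nneseriesD1 (n := i))//; last first.
  by move=> j _; rewrite lee_fin powR_ge0.
by rewrite leeDl// nneseries_ge0// => j _ _; rewrite lee_fin powR_ge0.
Qed.

Lemma lp_sum_delta i :
  lp_sum (k := k) (p := p) (fun j => (j == i)%:R) = 1%E :> \bar R.
Proof.
rewrite /lp_sum (nneseriesD1 (n := i))//; last first.
  by move=> j _; rewrite lee_fin powR_ge0.
rewrite eqxx eseries0 ?adde0.
  by rewrite -(@of_real1 R k) rnorm_of_real// powR1.
move=> j _; case/andP=> _ /negPf ->.
by rewrite (rnorm0 (V := K^o)) powR0.
Qed.

Lemma delta_lp i : (fun j => (j == i)%:R) \in lp_pred (k := k) p1.
Proof. by apply/asboolP; rewrite lp_sum_delta ltry. Qed.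

Definition basis i : X := Lp (delta_lp i).

Lemma basisE i j : basis i j = (j == i)%:R.
Proof. by []. Qed.

Lemma rnorm_basis i : rnorm (basis i) = 1.
Proof.
have := rnorm_powE (basis i); rewrite lp_sum_delta => -[].
rewrite -[RHS](congr1 (@^~ p) (powR1 R)) => /powR_injective.
by apply; rewrite ?nnegrE ?rnorm_ge0.
Qed.

Definition trunc n x : X := \sum_(i < n) x i *: basis i.

Definition tail n x : X := x - trunc n x.

Lemma truncE n x i : trunc n x i = if (i < n)%N then x i else 0.
Proof.
rewrite lp_coord_sum; under eq_bigr do rewrite lp_coordZ basisE mulr_natr mulrb.
rewrite -big_mkcond /=; case: ltnP => [ni|ni].
  by rewrite (big_pred1 (Ordinal ni))// => j; rewrite eq_sym -val_eqE.
by rewrite big_pred0// => j; apply: gtn_eqF; exact: leq_trans ni.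
Qed.

Lemma tailE n x i : tail n x i = if (i < n)%N then 0 else x i.
Proof. by rewrite lp_coordB truncE; case: ifP; rewrite ?subrr ?subr0. Qed.

Lemma trunc_linear n : linear (trunc n).
Proof.
move=> a x y; apply: lp_ext => i.
by rewrite !(truncE, lp_coordD, lp_coordZ); case: ifP; rewrite ?mulr0 ?addr0.
Qed.

HB.instance Definition _ n :=
  GRing.isLinear.Build K X X *:%R (trunc n) (trunc_linear n).

Lemma tail_linear n : linear (tail n).
Proof. by move=> a x y; rewrite /tail linearP scalerBr opprD addrACA. Qed.

HB.instance Definition _ n :=
  GRing.isLinear.Build K X X *:%R (tail n) (tail_linear n).

Lemma truncZ n (a : K) x : trunc n (a *: x) = a *: trunc n x.
Proof. exact: linearZ. Qed.

Lemma tailZ n (a : K) x : tail n (a *: x) = a *: tail n x.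
Proof. exact: linearZ. Qed.

Lemma trunc_tail n x : trunc n x + tail n x = x.
Proof. by rewrite addrC subrK. Qed.

Lemma rnorm_trunc_tail n x y :
  rnorm (trunc n x + tail n y) `^ p
    = rnorm (trunc n x) `^ p + rnorm (tail n y) `^ p.
Proof.
by apply: rnorm_pow_disjoint => i; rewrite truncE tailE; case: ifP; auto.
Qed.

Lemma rnorm_pow_split n x :
  rnorm x `^ p = rnorm (trunc n x) `^ p + rnorm (tail n x) `^ p.
Proof. by rewrite -rnorm_trunc_tail trunc_tail. Qed.

Lemma rnorm_trunc n x : rnorm (trunc n x) <= rnorm x.
Proof.
by rewrite rnorm_le_pow [leRHS](rnorm_pow_split n x) lerDl powR_ge0.
Qed.

Lemma rnorm_tail n x : rnorm (tail n x) <= rnorm x.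
Proof.
by rewrite rnorm_le_pow [leRHS](rnorm_pow_split n x) lerDr powR_ge0.
Qed.

Lemma rnorm_trunc_le_sum n x :
  rnorm (trunc n x) <= \sum_(i < n) rnorm (x i : K^o).
Proof.
apply: le_trans (rnorm_sum _ _) _; apply: ler_sum => i _.
by rewrite rnormZ rnorm_basis mulr1.
Qed.

Lemma tail_basis n i : (n <= i)%N -> tail n (basis i) = basis i.
Proof.
move=> ni; apply: lp_ext => j; rewrite tailE basisE; case: ifP => // jn.
by rewrite ltn_eqF// (leq_trans jn).
Qed.

Lemma tail_tail m n x : (m <= n)%N -> tail m (tail n x) = tail n x.
Proof.
move=> mn; apply: lp_ext => j; rewrite !tailE; case: ifP => // jm.
by rewrite (leq_trans jm mn).
Qed.

Lemma trunc_trunc n x : trunc n (trunc n x) = trunc n x.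
Proof. by apply: lp_ext => i; rewrite !truncE; case: (i < n)%N. Qed.

Lemma trunc_tail0 n x : trunc n (tail n x) = 0.
Proof. by apply: lp_ext => i; rewrite truncE tailE; case: (i < n)%N. Qed.

Lemma lp_sum_tail n x :
  lp_sum (p := p) (tail n x)
    = (\sum_(n <= i <oo) (rnorm (x i : K^o) `^ p)%:E)%E.
Proof.
rewrite /lp_sum (@nneseries_split _ _ 0 n); last first.
  by move=> i _; rewrite lee_fin powR_ge0.
rewrite add0n big1_seq ?add0e.
  apply/congr_lim/funext => m; apply: eq_big_nat => i /andP[ni _].
  by rewrite tailE ltnNge ni.
move=> i /andP[_]; rewrite mem_index_iota tailE => /andP[_ ->].
by rewrite (rnorm0 (V := K^o)) powR0.
Qed.

Lemma rnorm_tail_cvg x : rnorm (tail n x) @[n --> \oo] --> (0 : R).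
Proof.
have h : rnorm (tail n x) `^ p @[n --> \oo] --> (0 : R).
  have : (lp_sum (p := p) (tail n x) @[n --> \oo] --> 0)%E.
    under eq_fun do rewrite lp_sum_tail.
    apply: nneseries_tail_cvg => [|i _]; last by rewrite lee_fin powR_ge0.
    by rewrite -/(lp_sum _) -rnorm_powE ltry.
  under eq_fun do rewrite -rnorm_powE.
  by move/fine_cvg.
apply/cvgrPdist_lt => e e0.
have ep : 0 < e `^ p by rewrite powR_gt0.
move/cvgrPdist_lt : h => /(_ _ ep); apply: filterS => n.
rewrite !sub0r !normrN !ger0_norm ?powR_ge0 ?rnorm_ge0// !ltNge; apply: contra.
by move=> ?; rewrite ler_powR2r ?rnorm_ge0// ltW.
Qed.

End Coordinates.

(** * Operators and limits *)

Section RealNormOperators.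
Context {R : realType} {k : scalar_kind}.
Local Notation K := (scalars R k).
Implicit Types V W : normedModType K.

(** Rotating [b] onto the ray of [a] replaces a choice of sign in the real case
    and treats both kinds of scalars at once. *)
Lemma aligned_phase (a b : K) :
  exists2 c : K, `|c| = 1 & `|a + c * b| = `|a| + `|b|.
Proof.
have [s sP] : {s : K -> K | forall z, `|s z| = 1 /\ z = s z * `|z|}.
  exists (fun z => if z == 0 then 1 else z / `|z|) => z.
  have [->|z0] := eqVneq z 0; first by rewrite normr1 normr0 mulr0.
  by rewrite normf_div normr_id divff ?normr_eq0// divfK ?normr_eq0.
have [[na ea] [nb eb]] := (sP a, sP b).
have nb0 : s b != 0 by rewrite -normr_eq0 nb oner_eq0.
exists (s a / s b); first by rewrite normf_div na nb divr1.
by rewrite {1}ea {2}eb mulrA divfK// -mulrDr normrM na mul1r ger0_norm.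
Qed.

Lemma homogeneous_le V W (g : V -> W) (e : R) :
  (forall (a : K) x, g (a *: x) = a *: g x) ->
  (forall x, rnorm x <= 1 -> rnorm (g x) <= e) ->
  forall x, rnorm (g x) <= e * rnorm x.
Proof.
move=> gZ ge x.
have [->|x0] := eqVneq x 0.
  have g0 : g 0 = 0 by rewrite -[X in g X](scale0r (0 : V)) gZ scale0r.
  by rewrite g0 !rnorm0 mulr0.
have nx0 : `|x| != 0 by rewrite normr_eq0.
have h : rnorm (`|x|^-1 *: x) <= 1.
  by rewrite -rnorm_le1 normrZ normfV normr_id mulVf.
have nxE : rnorm (`|x| : K^o) = rnorm x by rewrite /rnorm normr_id.
rewrite -{1}[x](scalerKV nx0) gZ rnormZ nxE mulrC.
by rewrite ler_wpM2r ?rnorm_ge0// ge.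
Qed.

Lemma bounded_op_predP V W (g : V -> W) (M : R) : linear g ->
  (forall x, rnorm (g x) <= M * rnorm x) -> g \in bounded_op_pred V W.
Proof.
move=> lg gM; apply/asboolP; split=> //; exists (of_real k M) => x.
by rewrite -[`|x|]of_real_rnorm -of_realM rnorm_le.
Qed.

Lemma op_norm_le_rnorm V W (T : bounded_op V W) (M : R) : 0 <= M ->
  (forall x, rnorm (T x) <= M * rnorm x) -> op_norm T <= M.
Proof.
move=> M0 TM; apply: op_norm_le => x; rewrite rnorm_le1 => x1.
by rewrite (le_trans (TM x))// ler_piMr.
Qed.

Lemma cvg_rnormP (V : normedModType K) (I : Type) (F : set_system I)
    (u : I -> V) (l : V) : Filter F ->
  u @ F --> l <->
  (forall e : R, 0 < e -> \forall i \near F, rnorm (u i - l) <= e).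
Proof.
move=> FF; split=> [ul e e0|ul].
  have e0' : (0 : K) < of_real k e by rewrite -(@of_real0 R k) of_real_lt.
  have /cvgrPdistC_le/(_ _ e0') := ul.
  by apply: filterS => i; rewrite rnorm_le.
apply/cvgrPdistC_le => e e0.
have eE : of_real k (real_part e) = e by rewrite real_part_nneg// ltW.
have e1 : 0 < real_part e by rewrite -(@of_real_lt R k) eE of_real0.
by have := ul _ e1; apply: filterS => i; rewrite -rnorm_le eE.
Qed.

End RealNormOperators.

(** * Functionals are small on tails *)

Section DualTail.
Context {R : realType} {k : scalar_kind} {p : R} (p1 : 1 < p).
Local Notation K := (scalars R k).
Local Notation X := (lp k p1).

Let p_gt0 : 0 < p. Proof. exact: lt_trans p1. Qed.

Lemma coord_linear (i : nat) : linear (fun x : X => x i : K^o).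
Proof. by []. Qed.

Lemma coord_bound (i : nat) (x : X) : rnorm (x i : K^o) <= 1 * rnorm x.
Proof. by rewrite mul1r; exact: rnorm_coord. Qed.

Definition coord (i : nat) : dual X :=
  BoundedOp (bounded_op_predP (coord_linear i) (coord_bound i)).

(** Let y be a finitely supported vector of the unit ball at which f is within
    eta of its norm M. For u in the unit ball, supported beyond y, and a
    suitable phase c,
      M - eta + t |f u| <= |f (y + c t u)| <= M (1 + t^p)^(1/p) <= M (1 + t^p),
    so |f u| <= eta / t + M t^(p - 1). As p > 1, the last term is small for
    small t, and eta can then be chosen small with respect to t. *)
Lemma dual_tail_small (f : dual X) (e : R) : 0 < e ->
  \forall n \near \oo, forall x : X, rnorm (f (tail n x)) <= e * rnorm x.
Proof.
have chain1 (M eta A B C D : R) :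
    M - eta / 2 < A -> A <= B + C -> C <= D -> D <= eta / 2 -> M - eta <= B.
  by lra.
have chain2 (M t A B C : R) : M - t * (e / 2) <= A ->
    A + t * B <= C -> C <= M + t * (e / 2) -> t * B <= t * e.
  by lra.
move=> e0; pose M := op_norm f; have M0 : 0 <= M := op_norm_ge0 f.
have M1 : 0 < M + 1 by rewrite ltr_wpDl.
have q0 : 0 < p - 1 by rewrite subr_gt0.
(* The solution of (M + 1) t^(p - 1) = e / 2; using M + 1 avoids the case
   M = 0. *)
pose t := (e / 2 / (M + 1)) `^ (p - 1)^-1.
have t0 : 0 < t by rewrite powR_gt0// !divr_gt0.
have tp : M * t `^ p <= t * (e / 2).
  rewrite -mulr_powRB1 ?(ltW t0)// mulrCA ler_wpM2l ?(ltW t0)//.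
  rewrite /t -powRrM mulVf ?gt_eqF// powRr1 ?divr_ge0 ?(ltW e0) ?(ltW M1)//.
  rewrite mulrA ler_pdivrMr// mulrC ler_wpM2l ?divr_ge0 ?(ltW e0)//.
  by rewrite lerDl.
pose eta := t * (e / 2).
have eta0 : 0 < eta by rewrite mulr_gt0// divr_gt0.
have eta2 : 0 < eta / 2 by rewrite divr_gt0.
have [_ [y0 y01 <-] fy0] := sup_adherent eta2 (op_norm_has_sup f).
have [m tailm] : exists m, M * rnorm (tail m y0) <= eta / 2.
  have := rnorm_tail_cvg y0 => /cvgrPdist_lt /(_ _ (divr_gt0 eta2 M1)) [m _ ym].
  exists m; have := ym m (leqnn m).
  rewrite sub0r normrN ger0_norm ?rnorm_ge0// ltr_pdivlMr// => /ltW.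
  apply: le_trans.
  by rewrite mulrC ler_wpM2l ?rnorm_ge0// lerDl.
pose y := trunc m y0.
have y1 : rnorm y <= 1.
  by rewrite (le_trans (rnorm_trunc _ _))// -rnorm_le1.
have fy : M - eta <= rnorm (f y).
  have := rnormD (f y) (f (tail m y0)); rewrite -linearD trunc_tail => fyD.
  exact: chain1 fy0 fyD (rnorm_op_le f (tail m y0)) tailm.
(* From here on the tails start beyond the support of y. *)
exists m => // n /= mn; apply: homogeneous_le => [a x|x x1].
  by rewrite !linearZ.
pose u := tail n x.
have u1 : rnorm u <= 1 by rewrite (le_trans (rnorm_tail _ _)).
have [c nc fc] := aligned_phase (f y) (f (of_real k t *: u)).
pose w := tail m (c *: (of_real k t *: u)).
have nw : rnorm w <= t.
  rewrite (le_trans (rnorm_tail _ _))// !rnormZ rnorm_of_real ?(ltW t0)//.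
  have -> : rnorm (c : K^o) = 1.
    by rewrite /rnorm nc -(of_real1 (k := k)) of_realK.
  by rewrite mul1r ler_piMr// ltW.
have wE : w = c *: (of_real k t *: u).
  by rewrite /w !tailZ /u tail_tail.
have nyw : rnorm (y + w) <= 1 + t `^ p.
  have t1 : 0 <= 1 + t `^ p by rewrite addr_ge0 ?powR_ge0.
  have yw : rnorm (y + w) `^ p <= 1 + t `^ p.
    apply: le_trans (_ : rnorm y `^ p + rnorm w `^ p <= _).
      by rewrite le_eqVlt [X in X == _](rnorm_trunc_tail m) eqxx.
    apply: lerD; last by rewrite ler_powR2r ?rnorm_ge0// ltW.
    by rewrite ler_powR_1 ?rnorm_ge0.
  rewrite -(@ler_powR2r _ p) ?rnorm_ge0//; apply: le_trans yw _.
  by rewrite le1r_powR ?(ltW p1)// lerDl powR_ge0.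
have fE : f (y + w) = f y + c * f (of_real k t *: u).
  by rewrite linearD wE linearZ.
have fyw : rnorm (f (y + w)) = rnorm (f y) + t * rnorm (f u).
  apply: (can_inj (@of_realK R k)).
  rewrite of_realD of_realM !of_real_rnorm fE fc.
  congr (_ + _); rewrite linearZ normrZ; congr (_ * _).
  by rewrite -(of_real_rnorm (of_real k t : K^o)) rnorm_of_real// ltW.
rewrite -(ler_pM2l t0); apply: chain2 fy _ _.
  by rewrite -fyw; exact: rnorm_op_le.
by rewrite (le_trans (ler_wpM2l M0 nyw))// mulrDr mulr1 lerD2l.
Qed.

End DualTail.

(** * Approximation by operators that fix a basis vector *)

Section Approximants.
Context {R : realType} {k : scalar_kind} {p : R} (p1 : 1 < p).
Local Notation X := (lp k p1).
Implicit Types (T : bounded_op X X) (x : X) (n : nat).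

Let p_gt0 : 0 < p. Proof. exact: lt_trans p1. Qed.

Definition ratio n : R := 1 - harmonic n.

Lemma ratio_ge0 n : 0 <= ratio n.
Proof. by rewrite subr_ge0 invf_le1// ler1n. Qed.

Lemma ratio_lt1 n : ratio n < 1.
Proof. by rewrite ltrBlDr ltrDl harmonic_gt0. Qed.

Lemma near_ratio_small (M e : R) : 0 <= M -> 0 < e ->
  \forall n \near \oo, (1 - ratio n) * M <= e.
Proof.
move=> M0 e0; have M1 : 0 < M + 1 by rewrite ltr_wpDl.
have /cvgrPdistC_le/(_ _ (divr_gt0 e0 M1)) := @cvg_harmonic R.
apply: filterS => n; rewrite subr0 ger0_norm ?harmonic_ge0// ler_pdivlMr//.
rewrite /ratio subKr; apply: le_trans.
by rewrite ler_wpM2l ?harmonic_ge0// lerDl.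
Qed.

Definition compress T n x : X := of_real k (ratio n) *: trunc n (T (trunc n x)).

(** For a contraction T, the factor [ratio n < 1] makes the first block a strict
    contraction, while the second summand makes the operator norm equal to 1. *)
Definition approx_fun T n x : X := compress T n x + x n *: basis p1 n.

Lemma approx_linear T n : linear (approx_fun T n).
Proof.
move=> a x y; rewrite /approx_fun /compress.
rewrite trunc_linear bounded_op_linear trunc_linear lp_coordD lp_coordZ.
by rewrite scalerDl !scalerDr !scalerA [_ * a]mulrC addrACA.
Qed.

Lemma rnorm_compress T n x :
  rnorm (compress T n x) <= ratio n * (op_norm T * rnorm (trunc n x)).
Proof.
rewrite rnormZ rnorm_of_real ?ratio_ge0// ler_wpM2l ?ratio_ge0//.
by apply: le_trans (rnorm_trunc _ _) _; exact: rnorm_op_le.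
Qed.

Lemma rnorm_coord_basis n x : rnorm (x n *: basis p1 n) <= rnorm (tail n x).
Proof.
rewrite rnormZ rnorm_basis mulr1.
by apply: le_trans (rnorm_coord (tail n x) n); rewrite tailE ltnn.
Qed.

Lemma approx_bound T n x :
  rnorm (approx_fun T n x) <= (op_norm T + 1) * rnorm x.
Proof.
apply: le_trans (rnormD _ _) _; rewrite mulrDl mul1r; apply: lerD.
  apply: le_trans (rnorm_compress _ _ _) _.
  apply: le_trans (_ : op_norm T * rnorm (trunc n x) <= _).
    by rewrite ler_piMl ?(ltW (ratio_lt1 _))// mulr_ge0 ?op_norm_ge0 ?rnorm_ge0.
  by apply: ler_wpM2l; [exact: op_norm_ge0|exact: rnorm_trunc].
by apply: le_trans (rnorm_coord_basis _ _) _; exact: rnorm_tail.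
Qed.

Definition approx T n : bounded_op X X :=
  BoundedOp (bounded_op_predP (approx_linear T n) (approx_bound T n)).

Lemma approxE T n x : approx T n x = compress T n x + x n *: basis p1 n.
Proof. by []. Qed.

(** The two summands of [approx T n x] have disjoint supports: one is a
    truncation, the other a tail. *)
Lemma compress_trunc T n x :
  compress T n x = trunc n (of_real k (ratio n) *: T (trunc n x)).
Proof. by rewrite truncZ. Qed.

Lemma coord_basis_tail n x : x n *: basis p1 n = tail n (x n *: basis p1 n).
Proof. by rewrite tailZ tail_basis. Qed.

Lemma rnorm_compress_contraction T n x : op_norm T <= 1 ->
  rnorm (compress T n x) <= ratio n * rnorm (trunc n x).
Proof.
move=> T1; apply: le_trans (rnorm_compress _ _ _) _.
apply: ler_wpM2l; first exact: ratio_ge0.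
by rewrite ler_piMl ?rnorm_ge0.
Qed.

Lemma op_norm_approx T n : op_norm T <= 1 -> op_norm (approx T n) <= 1.
Proof.
move=> T1; apply: op_norm_le_rnorm => // x; rewrite mul1r.
rewrite rnorm_le_pow [leRHS](rnorm_pow_split n).
have approx_pow : rnorm (approx T n x) `^ p
    = rnorm (compress T n x) `^ p + rnorm (x n *: basis p1 n) `^ p.
  have := rnorm_trunc_tail n (of_real k (ratio n) *: T (trunc n x))
                             (x n *: basis p1 n).
  by rewrite -compress_trunc -coord_basis_tail -approxE.
rewrite [leLHS]approx_pow; apply: lerD; rewrite -rnorm_le_pow.
  apply: le_trans (rnorm_compress_contraction n x T1) _.
  by rewrite ler_piMl ?rnorm_ge0// ltW// ratio_lt1.
exact: rnorm_coord_basis.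
Qed.

Lemma compress_sub T n x : compress T n x - trunc n (T (trunc n x))
  = - (of_real k (1 - ratio n) *: trunc n (T (trunc n x))).
Proof.
by rewrite of_realB of_real1 scalerBl scale1r opprB.
Qed.

(** The difference splits into four pieces: the loss (1 - r) P T P x, the
    truncation P T Q x at the source, the truncation Q T x at the target, and
    the added term, which is bounded by |Q x|. *)
Lemma approx_cvg_eval T x : op_norm T <= 1 ->
  approx T n x @[n --> \oo] --> T x.
Proof.
move=> T1; apply/cvg_rnormP => e e0.
have eE : e = e / 4 + e / 4 + e / 4 + e / 4 by lra.
have e4 : 0 < e / 4 by rewrite divr_gt0.
have Tle y : rnorm (T y) <= rnorm y.
  by apply: le_trans (rnorm_op_le T y) _; rewrite ler_piMl ?rnorm_ge0.
have small (u : X) : \forall n \near \oo, rnorm (tail n u) <= e / 4.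
  have := rnorm_tail_cvg u => /cvgrPdistC_le/(_ _ e4).
  by apply: filterS => n; rewrite subr0 ger0_norm ?rnorm_ge0.
have := near_ratio_small (rnorm_ge0 x) e4.
apply: filterS3 (small x) (small (T x)) => n xn Txn rn.
have -> : approx T n x - T x
    = (compress T n x - trunc n (T (trunc n x))) + - trunc n (T (tail n x))
      + - tail n (T x) + x n *: basis p1 n.
  have TxE : T x
      = trunc n (T (trunc n x)) + trunc n (T (tail n x)) + tail n (T x).
    by rewrite -linearD -linearD trunc_tail trunc_tail.
  rewrite approxE {1}TxE !opprD addrAC; congr (_ + _).
  by rewrite !addrA.
rewrite eE; apply: rnormD4.
- rewrite compress_sub rnormN rnormZ rnorm_of_real; last first.
    by rewrite subr_ge0 ltW// ratio_lt1.
  apply: le_trans rn; apply: ler_wpM2l.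
    by rewrite subr_ge0 ltW// ratio_lt1.
  apply: le_trans (rnorm_trunc _ _) _; apply: le_trans (Tle _) _.
  exact: rnorm_trunc.
- rewrite rnormN; apply: le_trans (rnorm_trunc _ _) _.
  exact: le_trans (Tle _) xn.
- by rewrite rnormN.
- exact: le_trans (rnorm_coord_basis _ _) xn.
Qed.

(** The same splitting, now uniform in x: composed with f, the truncations at
    the target and at the source are governed by the tails of f and of its
    image under the adjoint of T. *)
Lemma approx_cvg_adjoint T (f : dual X) : op_norm T <= 1 ->
  adjoint (approx T n) f @[n --> \oo] --> adjoint T f.
Proof.
move=> T1; apply/cvg_rnormP => e e0.
have e4 : 0 < e / 4 by rewrite divr_gt0.
have eE : e = e / 4 + e / 4 + e / 4 + e / 4 by lra.
have Tle y : rnorm (T y) <= rnorm y.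
  by apply: le_trans (rnorm_op_le T y) _; rewrite ler_piMl ?rnorm_ge0.
have := near_ratio_small (op_norm_ge0 f) e4.
apply: filterS3 (dual_tail_small f e4) (dual_tail_small (adjoint T f) e4).
move=> n fn fTn rn; rewrite rnorm_op; apply: op_norm_le_rnorm; first exact: ltW.
move=> x.
have -> : (adjoint (approx T n) f - adjoint T f) x
    = f (compress T n x - trunc n (T (trunc n x)))
      + - f (tail n (T (trunc n x))) + - adjoint T f (tail n x)
      + f (tail n (x n *: basis p1 n)).
  have -> : (adjoint (approx T n) f - adjoint T f) x
      = f (approx T n x) - f (T x) by [].
  rewrite approxE -coord_basis_tail linearD linearB.
  have fTE : f (T x) = f (trunc n (T (trunc n x))) + f (tail n (T (trunc n x)))
      + adjoint T f (tail n x).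
    rewrite -linearD trunc_tail -[adjoint _ _ _]/(f (T _)).
    by rewrite -linearD -linearD trunc_tail.
  rewrite fTE !opprD addrAC; congr (_ + _).
  by rewrite !addrA.
rewrite eE !mulrDl; apply: rnormD4.
- rewrite compress_sub linearN rnormN linearZ rnormZ rnorm_of_real; last first.
    by rewrite subr_ge0 ltW// ratio_lt1.
  apply: le_trans (ler_wpM2r (rnorm_ge0 x) rn); rewrite -mulrA.
  apply: ler_wpM2l; first by rewrite subr_ge0 ltW// ratio_lt1.
  apply: le_trans (rnorm_op_le f _) _.
  apply: ler_wpM2l; first exact: op_norm_ge0.
  apply: le_trans (rnorm_trunc _ _) _; apply: le_trans (Tle _) _.
  exact: rnorm_trunc.
- rewrite rnormN; apply: le_trans (fn _) _; apply: ler_wpM2l; first exact: ltW.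
  by apply: le_trans (Tle _) _; exact: rnorm_trunc.
- by rewrite rnormN; exact: fTn.
- apply: le_trans (fn _) _; apply: ler_wpM2l; first exact: ltW.
  by apply: le_trans (rnorm_coord_basis _ _) _; exact: rnorm_tail.
Qed.

Lemma approx_cvg T : op_norm T <= 1 ->
  (approx T n : sot_star X) @[n --> \oo] --> (T : sot_star X).
Proof.
move=> T1; apply/cvg_sot_star; split=> [x|f].
  exact: approx_cvg_eval.
exact: approx_cvg_adjoint.
Qed.

End Approximants.

(** * Norm attainment is impossible near the approximants *)

Lemma nowhere_dense_escape (Z : topologicalType) (A : set Z) :
  (forall (U : set Z) z, open U -> U z -> exists2 w, U w & nbhs w (~` A)) ->
  nowhere_dense A.
Proof.
move=> escape; rewrite /nowhere_dense -subset0 => z Az.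
have [w /interior_subset Aw wA] := escape _ z (open_interior _) Az.
by have [v [Av nAv]] := Aw _ wA.
Qed.

Section NonAttaining.
Context {R : realType} {k : scalar_kind} {p : R} (p1 : 1 < p).
Local Notation K := (scalars R k).
Local Notation X := (lp k p1).
Implicit Types (T S : bounded_op X X) (x : X) (n : nat) (d e : R).

Let p_gt0 : 0 < p. Proof. exact: lt_trans p1. Qed.

(** An upper bound for |r P T P x + Q S Q x| when |x| <= 1 and |P x| >= d. *)
Definition cap n d : R := (1 - (1 - ratio n `^ p) * d `^ p) `^ p^-1.

Lemma ratio_powR_lt1 n : (ratio n : R) `^ p < 1.
Proof. by rewrite ltr_powR_1 ?ratio_ge0 ?ratio_lt1. Qed.

Lemma cap_lt1 n d : 0 < d -> d <= 1 -> cap n d < 1.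
Proof.
move=> d0 d1; have r1 := ratio_powR_lt1 n.
apply: ltr_powR_1; first by rewrite invr_gt0.
  rewrite subr_ge0 mulr_ile1 ?powR_ge0 ?subr_ge0 ?(ltW r1)//.
    by rewrite gerBl powR_ge0.
  by rewrite ler_powR_1// ltW.
by rewrite ltrBlDr ltrDl mulr_gt0 ?subr_gt0// powR_gt0.
Qed.

Lemma approx_trunc T n x : approx T n (trunc n x) = compress T n x.
Proof. by rewrite approxE /compress trunc_trunc truncE ltnn scale0r addr0. Qed.

Lemma approx_tail T n x : approx T n (tail n x) = x n *: basis p1 n.
Proof.
rewrite approxE /compress trunc_tail0 linear0 [trunc n 0]linear0 scaler0 add0r.
by rewrite tailE ltnn.
Qed.

Lemma approx_basis T n : approx T n (basis p1 n) = basis p1 n.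
Proof.
rewrite -[X in approx T n X](tail_basis p1 (leqnn n)) approx_tail.
by rewrite basisE eqxx scale1r.
Qed.

(** The first two terms are the part of [S x] that is controlled by [cap]. The
    others are the error, which depends on [S - approx T n] only through
    finitely many columns and finitely many rows: the two kinds of data that an
    SOT* neighbourhood controls. The rows may be compared with those of
    [approx T n] because the truncation of [approx T n (tail n x)] vanishes. *)
Lemma near_approx_split T S n x : S x
  = compress T n x + tail n (S (tail n x))
    + (\sum_(i < n) x i *: (S (basis p1 i) - approx T n (basis p1 i))
       + trunc n (S (tail n x) - approx T n (tail n x))).
Proof.
have op_trunc (L : bounded_op X X) :
    L (trunc n x) = \sum_(i < n) x i *: L (basis p1 i).
  by rewrite /trunc linear_sum; apply: eq_bigr => i _; rewrite linearZ.
have -> : \sum_(i < n) x i *: (S (basis p1 i) - approx T n (basis p1 i))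
    = S (trunc n x) - compress T n x.
  rewrite -approx_trunc !op_trunc -sumrB; apply: eq_bigr => i _.
  by rewrite scalerBr.
have -> : trunc n (S (tail n x) - approx T n (tail n x))
    = trunc n (S (tail n x)).
  have truncB (u v : X) : trunc n (u - v) = trunc n u - trunc n v.
    exact: linearB.
  by rewrite truncB approx_tail coord_basis_tail trunc_tail0 subr0.
have SE : S x = S (trunc n x) + S (tail n x) by rewrite -linearD trunc_tail.
rewrite SE -[in LHS](trunc_tail n (S (tail n x))).
by rewrite addrACA [compress T n x + _]addrC subrK [tail n _ + _]addrC.
Qed.

Lemma rnorm_compress_tail T S n x d : op_norm T <= 1 -> op_norm S <= 1 ->
  0 <= d -> d <= rnorm (trunc n x) -> rnorm x <= 1 ->
  rnorm (compress T n x + tail n (S (tail n x))) <= cap n d.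
Proof.
have chain (a t l D : R) :
    a <= 1 -> t + l <= 1 -> D <= t -> a * t + l <= 1 - (1 - a) * D.
  move=> a1 tl Dt; have : (1 - a) * D <= (1 - a) * t.
    by rewrite ler_wpM2l ?subr_ge0.
  by lra.
move=> T1 S1 d0 dx x1; pose y := compress T n x + tail n (S (tail n x)).
have yp : rnorm y `^ p <= 1 - (1 - ratio n `^ p) * d `^ p.
  apply: le_trans (_ : ratio n `^ p * rnorm (trunc n x) `^ p
                       + rnorm (tail n x) `^ p <= _); last first.
    apply: chain; first by rewrite ltW// ratio_powR_lt1.
      by rewrite -rnorm_pow_split ler_powR_1 ?rnorm_ge0.
    by rewrite ler_powR2r ?rnorm_ge0.
  have y_pow : rnorm y `^ p
      = rnorm (compress T n x) `^ p + rnorm (tail n (S (tail n x))) `^ p.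
    by rewrite /y compress_trunc; exact: rnorm_trunc_tail.
  rewrite [leLHS]y_pow; apply: lerD.
    rewrite -powRM ?ratio_ge0 ?rnorm_ge0//.
    rewrite ler_powR2r ?mulr_ge0 ?ratio_ge0 ?rnorm_ge0//.
    exact: rnorm_compress_contraction n x T1.
  rewrite -rnorm_le_pow; apply: le_trans (rnorm_tail _ _) _.
  by apply: le_trans (rnorm_op_le S _) _; apply: ler_piMl S1; exact: rnorm_ge0.
have c0 := le_trans (powR_ge0 _ _) yp.
rewrite -/y -[leLHS]powRr1 ?rnorm_ge0// -(@mulfV _ p) ?gt_eqF// powRrM.
by rewrite ler_powR2r ?invr_gt0 ?powR_ge0.
Qed.

Lemma near_approx_bound T S n x d e : op_norm T <= 1 -> op_norm S <= 1 ->
  (forall i : 'I_n, rnorm (S (basis p1 i) - approx T n (basis p1 i)) <= e) ->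
  (forall i : 'I_n, forall y : X,
    rnorm ((S y - approx T n y : X) i : K^o) <= e * rnorm y) ->
  0 <= e -> 0 <= d -> d <= rnorm (trunc n x) -> rnorm x <= 1 ->
  rnorm (S x) <= cap n d + (e *+ n + e *+ n).
Proof.
move=> T1 S1 Se Sc e0 d0 dx x1; rewrite [S x](near_approx_split T S n x).
apply: le_trans (rnormD _ _) _; apply: lerD.
  exact: rnorm_compress_tail T1 S1 d0 dx x1.
apply: le_trans (rnormD _ _) _; apply: lerD.
  apply: le_trans (rnorm_sum _ _) _.
  rewrite -[n in e *+ n]card_ord -sumr_const; apply: ler_sum => i _.
  rewrite rnormZ; apply: le_trans (Se i).
  apply: ler_piMl; first exact: rnorm_ge0.
  exact: le_trans (rnorm_coord _ _) x1.
apply: le_trans (rnorm_trunc_le_sum _ _) _.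
rewrite -[n in e *+ n]card_ord -sumr_const; apply: ler_sum => i _.
apply: le_trans (Sc i _) _; apply: ler_piMr; first exact: e0.
exact: le_trans (rnorm_tail _ _) x1.
Qed.

Definition non_attaining_above n d : set (sot_star X) :=
  [set S | op_norm S <= 1 -> forall x, rnorm x <= 1 ->
    d <= rnorm (trunc n x) -> rnorm (bounded_op_val S x) < op_norm S].

(** A contraction close to [approx T n] has norm at least 1 - e, by its value at
    the n-th basis vector, but maps the vectors x of the unit ball with
    |P x| >= d to vectors of norm at most cap + 2 n e < 1 - e. *)
Lemma near_approx_non_attaining T n d : op_norm T <= 1 -> 0 < d -> d <= 1 ->
  nbhs (approx T n : sot_star X) (non_attaining_above n d).
Proof.
move=> T1 d0 d1; pose e := (1 - cap n d) / (n + n).+2%:R.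
have cap1 := cap_lt1 n d0 d1.
have e0 : 0 < e by rewrite divr_gt0// subr_gt0.
(* [e] is the gap 1 - cap divided by 2 n + 2, so that 2 n + 1 errors do not
   fill the gap. *)
have eE : cap n d + (e *+ n + e *+ n) < 1 - e.
  rewrite ltrBrDl addrCA -ltrBrDl -mulrnDr -mulrS.
  rewrite -[ltRHS](@divfK _ (n + n).+2%:R) ?pnatr_eq0// -/e mulr_natr.
  by rewrite [ltRHS]mulrS ltrDr.
have [ev_cvg adj_cvg] :=
  (cvg_sot_star _ _).1 (@cvg_id _ (nbhs (approx T n : sot_star X))).
have nearS : \forall S \near nbhs (approx T n : sot_star X), forall i : 'I_n.+1,
    rnorm (bounded_op_val S (basis p1 i) - approx T n (basis p1 i)) <= e.
  by apply: filter_forall => i; have /cvg_rnormP := ev_cvg (basis p1 i); apply.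
have nearA : \forall S \near nbhs (approx T n : sot_star X), forall i : 'I_n,
    rnorm (adjoint S (coord p1 i) - adjoint (approx T n) (coord p1 i)) <= e.
  by apply: filter_forall => i; have /cvg_rnormP := adj_cvg (coord p1 i); apply.
apply: filterS2 nearS nearA => S Se Sa S1 x x1 dx.
have low : 1 - e <= op_norm S.
  have := Se ord_max; rewrite approx_basis /= => Sn.
  have Sb : rnorm (S (basis p1 n)) <= op_norm S.
    by apply: op_norm_ge; rewrite rnorm_le1 rnorm_basis.
  have := rnormD (S (basis p1 n)) (- (S (basis p1 n) - basis p1 n)).
  rewrite subKr rnormN rnorm_basis lerBlDr => /le_trans; apply.
  exact: lerD Sb Sn.
apply: lt_le_trans low; apply: le_lt_trans eE.
apply: (near_approx_bound T1 S1 _ _ (ltW e0) (ltW d0) dx x1) => [i|i y].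
  exact: Se (widen_ord (leqnSn n) i).
pose D : dual X := adjoint S (coord p1 i) - adjoint (approx T n) (coord p1 i).
apply: le_trans (rnorm_op_le D y) _.
by apply: ler_wpM2r; [exact: rnorm_ge0|rewrite -rnorm_op; exact: Sa].
Qed.

(** The same index bounds the position of the coordinate and the inverse of its
    modulus, so that a single sequence of sets covers all cases. *)
Definition attains_at_coord m : set (op_unit_ball X) :=
  [set T | exists x,
    [/\ `|x| <= 1,
        `|(sval T : bounded_op X X) x| = `|(sval T : bounded_op X X)|
      & exists2 j, (j <= m)%N & harmonic m <= rnorm (x j : K^o)]].

Lemma op_norm_unit_ball (T : op_unit_ball X) :
  op_norm (sval T : bounded_op X X) <= 1.
Proof.
have T1 : `|sval T : bounded_op X X| <= 1 := set_mem (svalP T).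
by rewrite rnorm_le1 rnorm_op in T1.
Qed.

Lemma approx_unit_ball_subproof (T : op_unit_ball X) n :
  (approx (sval T) n : sot_star X) \in op_unit_ball X.
Proof.
apply: mem_set; have : op_norm (approx (sval T) n) <= 1.
  exact: op_norm_approx (op_norm_unit_ball T).
by rewrite -rnorm_op -rnorm_le1.
Qed.

Definition approx_unit_ball (T : op_unit_ball X) n : op_unit_ball X :=
  exist (fun S => S \in op_unit_ball X) _ (approx_unit_ball_subproof T n).

Lemma approx_unit_ball_cvg (T : op_unit_ball X) :
  approx_unit_ball T n @[n --> \oo] --> T.
Proof.
move=> A; rewrite nbhsE => -[_ [[B oB <-] BT] BA].
have nB : nbhs (sval T : sot_star X) B by exact: open_nbhs_nbhs.
have [N _ NB] := approx_cvg (op_norm_unit_ball T) nB.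
by exists N => // n Nn; apply: BA; exact: NB.
Qed.

Lemma nbhs_unit_ball (T : op_unit_ball X) (A : set (sot_star X)) :
  nbhs (sval T : sot_star X) A -> nbhs T [set S : op_unit_ball X | A (sval S)].
Proof. exact: (@initial_continuous (op_unit_ball X) _ (@set_val _ _) T A). Qed.

Lemma nowhere_dense_attains_at_coord m : nowhere_dense (attains_at_coord m).
Proof.
apply: nowhere_dense_escape => U T oU UT.
have T1 := op_norm_unit_ball T.
have nU : nbhs T U by exact: open_nbhs_nbhs.
have [N _ UN] := approx_unit_ball_cvg nU.
(* Beyond [N] the approximants are in [U]; beyond [m] the truncation keeps the
   large coordinate. *)
pose n := maxn N m.+1.
exists (approx_unit_ball T n); first by apply: UN; exact: leq_maxl.
have d1 : harmonic m <= 1 :> R by rewrite invf_le1// ler1n.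
have near_S0 := near_approx_non_attaining n T1 (harmonic_gt0 m) d1.
have near_T0 := nbhs_unit_ball (T := approx_unit_ball T n) near_S0.
apply: (filterS _ near_T0).
move=> S nonattS [x [x1 Sx [j jm xj]]].
have xj' : harmonic m <= rnorm (trunc n x).
  apply: le_trans xj _; apply: le_trans (rnorm_coord (trunc n x) j).
  by rewrite truncE (leq_trans _ (leq_maxr N m.+1)).
have nx1 : rnorm x <= 1 by rewrite -rnorm_le1.
have := nonattS (op_norm_unit_ball S) x nx1 xj'.
have -> : rnorm (bounded_op_val (sval S) x)
    = op_norm (sval S : bounded_op X X).
  by rewrite -rnorm_op /rnorm Sx.
by rewrite ltxx.
Qed.

Lemma attains_norm_coord (T : op_unit_ball X) :
  attains_norm (sval T) <-> exists m, attains_at_coord m T.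
Proof.
split=> [[x x1 Tx]|[m [x [x1 Tx _]]]]; last by exists x.
have [y [y1 Ty y0]] : exists y : X,
    [/\ `|y| <= 1, `|(sval T : bounded_op X X) y| = `|(sval T : bounded_op X X)|
      & y != 0].
  (* Attaining the norm at 0 means T = 0, which attains it everywhere. *)
  have [x0|x0] := eqVneq x 0; last by exists x.
  have T0 : (sval T : bounded_op X X) = 0.
    by apply/normr0_eq0; rewrite -Tx x0 linear0 normr0.
  exists (basis p1 0); split.
  - by rewrite rnorm_le1 rnorm_basis.
  - by rewrite T0 !normr0.
  - apply/eqP => b0; have := rnorm_basis p1 0 (k := k).
    by rewrite b0 rnorm0 => /esym/eqP; rewrite oner_eq0.
have [j yj] : exists j, y j != 0.
  apply: contrapT => y_eq0; case/eqP: y0; apply: lp_ext => i.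
  by apply/eqP/negPn/negP => yi; apply: y_eq0; exists i.
have nyj : 0 < rnorm (y j : K^o).
  rewrite lt_def rnorm_ge0 andbT; apply: contra_neq yj.
  exact: (@rnorm_eq0 _ _ K^o).
have /cvgrPdistC_le/(_ _ nyj)[N _ hN] := @cvg_harmonic R.
exists (maxn N j), y; split => //; exists j; first exact: leq_maxr.
have := hN _ (leq_maxl N j).
by rewrite subr0 ger0_norm ?harmonic_ge0.
Qed.

End NonAttaining.

Theorem corollary6p2 (R : realType) (k : scalar_kind) (p : R) (p1 : 1 < p) :
  comeager [set T : op_unit_ball (lp k p1) | ~ attains_norm (sval T)].
Proof.
exists (attains_at_coord (p1 := p1)).
  exact: nowhere_dense_attains_at_coord.
apply/seteqP; split => T /=.
  by move=> /contrapT /attains_norm_coord [m Tm]; exists m.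
by move=> [m _ Tm]; apply; apply/attains_norm_coord; exists m.
Qed.
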